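(* Suppose that $dp=\mathrm{loop}(dp_0)$, where $dp_0$ has resource space $R_0$ and map $h_0$, and evaluating $h_0$ takes at most $c$ computation. Then the algorithm that evaluates the map $h$ of $dp$ by the Kleene iteration satisfies the following bounds on resource usage: - memory: $O(\mathrm{width}(R_0))$; - number of steps: $O(\mathrm{height}(\mathsf{A}R_0))$; - total computation: $O(\mathrm{width}(R_0)\times\mathrm{height}(\mathsf{A}R_0)\times c)$.
   Context: For a poset $P$, an antichain is a subset no two distinct elements of which are comparable (the empty set is one); $\mathsf{A}P$ is the set of antichains of $P$, ordered by $A\preceq_{\mathsf{A}P}B$ iff $\uparrow A\supseteq\,\uparrow B$, where $\uparrow S=\{y\in P:\exists x\in S,\ x\preceq y\}$ and $\uparrow r=\,\uparrow\{r\}$. $\mathrm{Min}\,S$ is the set of minimal elements of $S$. $\mathrm{width}(P)$ is the maximum cardinality of an antichain in $P$ and $\mathrm{height}(P)$ is the maximum cardinality of a chain in $P$ (possibly infinite). A design problem with implementation (DPI) is a tuple $\langle F,R,I,\mathrm{exec},\mathrm{eval}\rangle$ with posets $F,R$, a set $I$, and maps $\mathrm{exec}\colon I\to F$, $\mathrm{eval}\colon I\to R$; its map is $h\colon F\to\mathsf{A}R$, $f\mapsto\mathrm{Min}\{\mathrm{eval}(i)\mid i\in I,\ f\preceq\mathrm{exec}(i)\}$. It is *monotone* if $F,R$ are complete partial orders (every nonempty directed subset has a supremum, and there is a least element $\bot$) and $h$ is Scott continuous (for each nonempty directed $D$, $h(D)$ is directed and $h(\sup D)=\sup h(D)$). Here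 $dp_0=\langle F_1\times R_0,R_0,I,\langle\mathrm{exec}_1,\mathrm{exec}_2\rangle,\mathrm{eval}\rangle$ is a monotone DPI, obtained from monotone DPIs using only series and parallel composition, and $\mathrm{loop}(dp_0)=\langle F_1,R_0,I',\mathrm{exec}_1,\mathrm{eval}\rangle$ with $I'=\{i\in I:\mathrm{eval}(i)\preceq\mathrm{exec}_2(i)\}$. The series composition of $dp_1,dp_2$ (with $R_1=F_2$) is $\langle F_1,R_2,\{\langle i_1,i_2\rangle:\mathrm{eval}_1(i_1)\preceq\mathrm{exec}_2(i_2)\},\langle i_1,i_2\rangle\mapsto\mathrm{exec}_1(i_1),\langle i_1,i_2\rangle\mapsto\mathrm{eval}_2(i_2)\rangle$; the parallel composition is the componentwise product. The algorithm: given $f_1\in F_1$, the value $h(f_1)$ is computed as the least fixed point of $$\Psi_{f_1}\colon\mathsf{A}R_0\to\mathsf{A}R_0,\qquad S\mapsto\mathrm{Min}\bigcup_{r\in S}\big(h_0(f_1,r)\,\cap\uparrow r\big),$$ by the ascending iteration $S_0=\{\bot_{R_0}\}$, $S_{k+1}=\Psi_{f_1}(S_k)$, until $S_{k+1}=S_k$. The cost model: memory is the number of elements of $R_0$ in the state $S_k$; a step is one application of $\Psi_{f_1}$; total computation counts the evaluations of $h_0$, each of cost at most $c$. *)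

(* Defs.v *)
From HB Require Import structures.
From mathcomp Require Export all_boot all_order all_algebra.
From mathcomp Require Export boolp classical_sets functions cardinality.
From mathcomp Require Export reals ereal esum counting_measure.

Set Implicit Arguments.
Unset Strict Implicit.
Unset Printing Implicit Defensive.

Import Order.TTheory GRing.Theory Num.Theory.

Local Open Scope order_scope.
Local Open Scope classical_set_scope.

Definition upset {d} {P : porderType d} (S : set P) : set P :=
  [set y | exists2 x, S x & x <= y].

Definition is_antichain {d} {P : porderType d} (S : set P) : Prop :=
  forall x y, S x -> S y -> x != y -> ~~ (x >=< y).

Definition is_chain {d} {P : porderType d} (S : set P) : Prop :=
  forall x y, S x -> S y -> x >=< y.

Definition Min {d} {P : porderType d} (S : set P) : set P :=
  [set x | S x /\ forall y, S y -> ~~ (y < x)].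

Record antichains {d} (P : porderType d) := Antichain {
  antichain_set :> set P;
  antichain_setP : `[< is_antichain antichain_set >] }.

HB.instance Definition _ d (P : porderType d) :=
  [isSub for @antichain_set d P].
HB.instance Definition _ d (P : porderType d) :=
  [Choice of antichains P by <:].

Section AntichainOrder.
Context {d : Order.disp_t} {P : porderType d}.
Implicit Types A B C : antichains P.

Definition antichain_le A B : bool := `[< upset B `<=` upset A >].

Lemma antichain_le_refl : reflexive antichain_le.
Proof. by move=> A; apply/asboolP. Qed.

Lemma antichain_le_trans : transitive antichain_le.
Proof.
move=> B A C /asboolP BA /asboolP CB; apply/asboolP.
exact: subset_trans CB BA.
Qed.

Lemma antichain_sub_of_upset A B :
  upset B `<=` upset A -> upset A `<=` upset B -> A `<=` B.
Proof.
move=> BA AB x Ax.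
have [y By yx] : upset B x by apply: AB; exists x.
have [z Az zy] : upset A y by apply: BA; exists y.
have /asboolP acA := antichain_setP A.
have [xz|xz] := eqVneq x z.
  by have -> : x = y by apply/le_anti; rewrite yx xz zy.
by have := acA _ _ Ax Az xz; rewrite /Order.comparable (le_trans zy yx) orbT.
Qed.

Lemma antichain_le_anti : antisymmetric antichain_le.
Proof.
move=> A B /andP[/asboolP BA /asboolP AB]; apply/val_inj/seteqP.
by split; apply: antichain_sub_of_upset.
Qed.

End AntichainOrder.

Fact antichain_display : Order.disp_t. Proof. exact: Order.Disp tt tt. Qed.

HB.instance Definition _ d (P : porderType d) :=
  Order.Le_isPOrder.Build antichain_display (antichains P)
    antichain_le_refl antichain_le_anti antichain_le_trans.

Lemma is_antichain_Min {d} {P : porderType d} (S : set P) :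
  is_antichain (Min S).
Proof.
move=> x y [Sx mx] [Sy my] xy; apply/negP => /orP[] le.
  by have := my _ Sx; rewrite lt_neqAle xy le.
by have := mx _ Sy; rewrite lt_neqAle eq_sym xy le.
Qed.

Lemma is_antichain1 {d} {P : porderType d} (x : P) : is_antichain [set x].
Proof. by move=> y z -> ->; rewrite eqxx. Qed.

Definition antichain_Min {d} {P : porderType d} (S : set P) : antichains P :=
  Antichain (asboolT (@is_antichain_Min _ _ S)).

Definition antichain1 {d} {P : porderType d} (x : P) : antichains P :=
  Antichain (asboolT (@is_antichain1 _ _ x)).

(* Cardinalities take values in the extended reals, [counting X] being +oo
   when X is infinite, so width and height are +oo as soon as the (anti)chains
   have no finite bound on their size. *)
Definition width (K : realType) {d} (P : porderType d) : \bar K :=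
  ereal_sup [set counting S | S in @is_antichain d P].

Definition height (K : realType) {d} (P : porderType d) : \bar K :=
  ereal_sup [set counting S | S in @is_chain d P].

Definition directed {d} {P : porderType d} (D : set P) : Prop :=
  D !=set0 /\
  forall x y, D x -> D y -> exists z, [/\ D z, x <= z & y <= z].

Definition is_bottom {d} {P : porderType d} (b : P) : Prop :=
  forall x, b <= x.

Definition is_cpo {d} (P : porderType d) : Prop :=
  (exists b : P, is_bottom b) /\
  forall D : set P, directed D -> exists s, supremums D s.

Definition scott_continuous {d d'} {P : porderType d} {Q : porderType d'}
    (h : P -> Q) : Prop :=
  forall D : set P, directed D ->
    directed (h @` D) /\
    forall s, supremums D s -> supremums (h @` D) (h s).

Record DPI {dF dR} (F : porderType dF) (R : porderType dR) := MkDPI {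
  impl : Type;
  exec : impl -> F;
  eval : impl -> R }.

Definition dp_map {dF dR} {F : porderType dF} {R : porderType dR}
    (dp : DPI F R) (f : F) : antichains R :=
  antichain_Min [set eval i | i in [set i : impl dp | f <= exec i]].

Definition monotone_dpi {dF dR} {F : porderType dF} {R : porderType dR}
    (dp : DPI F R) : Prop :=
  [/\ is_cpo F, is_cpo R & scott_continuous (dp_map dp)].

Definition series {d1 d2 d3} {F1 : porderType d1} {R1 : porderType d2}
    {R2 : porderType d3} (dp1 : DPI F1 R1) (dp2 : DPI R1 R2) : DPI F1 R2 :=
  @MkDPI _ _ F1 R2
    {i : impl dp1 * impl dp2 | eval i.1 <= exec i.2}
    (fun i => exec (sval i).1)
    (fun i => eval (sval i).2).

(* [T *p T'] is the product type with the componentwise order. *)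
Definition parallel {d1 d2 d3 d4} {F1 : porderType d1} {R1 : porderType d2}
    {F2 : porderType d3} {R2 : porderType d4}
    (dp1 : DPI F1 R1) (dp2 : DPI F2 R2) : DPI (F1 *p F2) (R1 *p R2) :=
  @MkDPI _ _ (F1 *p F2) (R1 *p R2)
    (impl dp1 * impl dp2)
    (fun i => (exec i.1, exec i.2))
    (fun i => (eval i.1, eval i.2)).

Definition loop {d1 d0} {F1 : porderType d1} {R0 : porderType d0}
    (dp0 : DPI (F1 *p R0) R0) : DPI F1 R0 :=
  @MkDPI _ _ F1 R0
    {i : impl dp0 | eval i <= (exec i).2}
    (fun i => (exec (sval i)).1)
    (fun i => eval (sval i)).

Inductive series_parallel : forall {dF dR} {F : porderType dF}
    {R : porderType dR}, DPI F R -> Prop :=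
| sp_monotone dF dR (F : porderType dF) (R : porderType dR) (dp : DPI F R) :
    monotone_dpi dp -> series_parallel dp
| sp_series d1 d2 d3 (F1 : porderType d1) (R1 : porderType d2)
    (R2 : porderType d3) (dp1 : DPI F1 R1) (dp2 : DPI R1 R2) :
    series_parallel dp1 -> series_parallel dp2 ->
    series_parallel (series dp1 dp2)
| sp_parallel d1 d2 d3 d4 (F1 : porderType d1) (R1 : porderType d2)
    (F2 : porderType d3) (R2 : porderType d4)
    (dp1 : DPI F1 R1) (dp2 : DPI F2 R2) :
    series_parallel dp1 -> series_parallel dp2 ->
    series_parallel (parallel dp1 dp2).

Section Kleene.
Context {d1 d0 : Order.disp_t} {F1 : porderType d1} {R0 : porderType d0}.
Variables (dp0 : DPI (F1 *p R0) R0) (f1 : F1) (bot : R0).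

Definition kleene_step (S : antichains R0) : antichains R0 :=
  antichain_Min
    (\bigcup_(r in S) (dp_map dp0 (f1, r) `&` upset [set r])).

Definition kleene_state (k : nat) : antichains R0 :=
  iter k kleene_step (antichain1 bot).

(* Step k computes S_(k+1) from S_k. It is performed unless an earlier step
   already met the stopping test; all steps are if the test is never met. *)
Definition performed : set nat :=
  [set k | forall j, (j < k)%N -> kleene_state j.+1 <> kleene_state j].

Context {K : realType}.

(* All states are taken into account: those past the stopping point, if any,
   are equal to the final one. *)
Definition memory : \bar K :=
  ereal_sup (range (fun k => counting (kleene_state k))).

Definition num_steps : \bar K := counting performed.

(* Step k evaluates [dp_map dp0] at (f1, r) once for each r in S_k. *)
Definition computation (cost : F1 *p R0 -> K) : \bar K :=
  (\esum_(k in performed) \esum_(r in kleene_state k) (cost (f1, r))%:E)%R.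

End Kleene.
Arguments memory {d1 d0 F1 R0} dp0 f1 bot K.
Arguments num_steps {d1 d0 F1 R0} dp0 f1 bot K.

(* Main.v *)
(* Every element of Psi(S) lies above an element of S, so Psi is inflationary
   and the Kleene states ascend; up to the stopping test they are pairwise
   distinct, hence form a chain of AR_0 with one element per performed step.
   Each state is itself an antichain of R_0. The constant is 1. *)
Require Import Defs.
From mathcomp Require Import finmap fsbigop.
Set Implicit Arguments.
Unset Strict Implicit.
Unset Printing Implicit Defensive.
Import Order.TTheory GRing.Theory Num.Theory.
Local Open Scope classical_set_scope.
Local Open Scope ereal_scope.

Lemma counting_ge0 (K : realType) (T : choiceType) (A : set T) :
  0 <= counting A :> \bar K.
Proof. by rewrite /counting; case: ifPn; rewrite ?lee_fin ?leey. Qed.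

Lemma le_counting (K : realType) (T : choiceType) (A B : set T) :
  A `<=` B -> counting A <= counting B :> \bar K.
Proof.
move=> AB; rewrite /counting; case: (asboolP (finite_set B)) => [finB|_].
  rewrite asboolT; last exact: sub_finite_set finB.
  rewrite lee_fin ler_nat; apply: fsubset_leq_card.
  by rewrite -fset_set_sub //; exact: sub_finite_set finB.
by rewrite leey.
Qed.

Lemma counting_image (K : realType) (T U : choiceType) (f : T -> U)
    (A : set T) :
  set_inj A f -> counting (f @` A) = counting A :> \bar K.
Proof.
move=> /inj_card_eq fA; rewrite /counting (eq_finite_set fA).
case: asboolP => // /finite_setP[n An]; congr (_%:R%:E).
by rewrite (card_fset_set An) (card_fset_set (card_eq_trans fA An)).
Qed.

(** The sum is a supremum over finite [X] inside [A], and each such partial sum is [counting X * x].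
    This also covers infinite [A] with [x = 0], where [+oo * 0] is [0]. *)
Lemma esum_cst_le (K : realType) (T : choiceType) (A : set T) (x : \bar K) :
  0 <= x -> (\esum_(i in A) x)%R <= counting A * x.
Proof.
move=> x0; apply: ge_ereal_sup => _ [X [finX XA] <-].
apply: le_trans (lee_wpmul2r x0 (le_counting K XA)).
rewrite fsbig_finite //= /counting asboolT // mule_natl.
by rewrite big_const_seq count_predT iter_addr_0.
Qed.

Section KleeneBounds.
Context {d1 d0 : Order.disp_t} {F1 : porderType d1} {R0 : porderType d0}.
Variables (dp0 : DPI (F1 *p R0) R0) (f1 : F1) (bot : R0).
Local Notation state := (kleene_state dp0 f1 bot).

Lemma kleene_step_inflationary (S : antichains R0) :
  (S <= kleene_step dp0 f1 S)%O.
Proof.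
(* The order is reversed inclusion of upper sets. Here [y] lies above [x] in the new state, and the
   factor [upset [set r]] puts [x] above [r] in [S]. *)
apply/asboolP => y [x [[r Sr [_ [_ -> rx]]] _] xy].
by exists r => //; exact: le_trans rx xy.
Qed.

Lemma kleene_state_nondecreasing : {homo state : i j / (i <= j)%N >-> (i <= j)%O}.
Proof.
by apply: homo_leq => // [? ? ?|i]; [exact: le_trans|exact: kleene_step_inflationary].
Qed.

Lemma kleene_state_inj : set_inj (performed dp0 f1 bot) state.
Proof.
have distinct i j : performed dp0 f1 bot j -> (i < j)%N -> state i <> state j.
  (* The stopping test compares only neighbours, but a repetition [state i = state j] squeezes
     [state i.+1] between two equal states, so the test is already met at [i], before [j]. *)
  move=> pj ij eij; apply: (pj i ij); apply/le_anti.
  rewrite [X in _ && X]kleene_step_inflationary andbT eij.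
  exact: kleene_state_nondecreasing.
move=> i j /set_mem pi /set_mem pj eij.
case: (ltngtP i j) => // [/(distinct _ _ pj)|/(distinct _ _ pi)] //.
by rewrite eij.
Qed.

Lemma counting_kleene_state_le_width (K : realType) k :
  counting (state k) <= width K R0.
Proof.
apply: ereal_sup_ubound; exists (state k) => //.
exact/asboolP/antichain_setP.
Qed.

Lemma num_steps_le_height (K : realType) :
  num_steps dp0 f1 bot K <= height K (antichains R0).
Proof.
rewrite /num_steps -(counting_image K kleene_state_inj).
apply: ereal_sup_ubound; eexists; last by [].
move=> _ _ [i _ <-] [j _ <-]; rewrite /Order.comparable.
by case/orP: (leq_total i j) => /kleene_state_nondecreasing ->; rewrite ?orbT.
Qed.

Lemma computation_le (K : realType) (cost : F1 *p R0 -> K) (c : K) :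
  (forall x, 0 <= cost x <= c)%R ->
  computation dp0 f1 bot cost
    <= width K R0 * height K (antichains R0) * c%:E.
Proof.
move=> costP.
have c0 : 0 <= c%:E.
  (* Any point of the domain would do: its cost lies between [0] and [c]. *)
  by rewrite lee_fin; have /andP[/le_trans] := costP (f1, bot); exact.
have w0 : 0 <= width K R0.
  exact: le_trans (counting_ge0 _ _) (counting_kleene_state_le_width K 0).
have wc0 : 0 <= width K R0 * c%:E by exact: mule_ge0.
(* Regrouped as [height * (width * c)] to match the nested sums: at most [height] steps, each
   costing at most [width * c]. The signs established above allow multiplying inequalities between
   possibly infinite factors. *)
rewrite (muleC (width _ _)) -muleA.
apply: le_trans (lee_wpmul2r wc0 (num_steps_le_height K)).
apply: le_trans (esum_cst_le _ wc0); apply: le_esum => k _.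
apply: le_trans (lee_wpmul2r c0 (counting_kleene_state_le_width K k)).
apply: le_trans (esum_cst_le _ c0); apply: le_esum => r _.
by rewrite lee_fin; case/andP: (costP (f1, r)).
Qed.

End KleeneBounds.

Theorem proposition5 :
  exists C : nat,
  forall (K : realType) (d1 d0 : Order.disp_t)
    (F1 : porderType d1) (R0 : porderType d0)
    (dp : DPI F1 R0) (dp0 : DPI (F1 *p R0) R0)
    (cost : F1 *p R0 -> K) (c : K),
  monotone_dpi dp0 ->
  series_parallel dp0 ->
  dp = loop dp0 ->
  (forall x, 0 <= cost x <= c)%R ->
  forall (f1 : F1) (bot : R0), is_bottom bot ->
  [/\ memory dp0 f1 bot K <= C%:R%:E * width K R0,
      num_steps dp0 f1 bot K <= C%:R%:E * height K (antichains R0) &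
      computation dp0 f1 bot cost
        <= C%:R%:E * (width K R0 * height K (antichains R0) * c%:E)].
Proof.
exists 1%N => K d1 d0 F1 R0 dp dp0 cost c _ _ _ costP f1 bot _.
rewrite !mul1e; split.
- by apply: ge_ereal_sup => _ [k _ <-]; exact: counting_kleene_state_le_width.
- exact: num_steps_le_height.
- exact: computation_le.
Qed.
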